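(* $\mathcal{B}^{\mathcal{O}}_{res}$ is a functor from $\mathbf{Hyp}$ to $\mathbf{Simp}$.
   Context: $\mathbf{Hyp}$ is the category of finite hypergraphs without multi-edges. Objects are pairs $\mathcal{H}=(V,E)$ with $V$ a finite set and $E\subseteq\mathcal{P}(V)$ (the empty set is allowed as a hyperedge). A morphism from $(V,E)$ to $(V',E')$ is a function $f:V\to V'$ such that $\{f(v):v\in e\}\in E'$ for all $e\in E$. $\mathbf{Simp}$ is the category of abstract simplicial complexes. An object is a collection $K$ of nonempty subsets (simplices) of a base set $X$ closed under taking nonempty subsets. A morphism from $K_1$ on $X_1$ to $K_2$ on $X_2$ is a simplicial map, i.e. a function $g:X_1\to X_2$ such that $\{g(x):x\in\sigma\}\in K_2$ for every $\sigma\in K_1$. For $\mathcal{H}=(V,E)$ in $\mathbf{Hyp}$, let $\mathcal{O}(\mathcal{H})=(E,\subseteq)$ be the poset of hyperedges ordered by containment. On objects, $\mathcal{B}^{\mathcal{O}}_{res}(\mathcal{H})$ is the order complex of $\mathcal{O}(\mathcal{H})$: the simplicial complex on base set $E$ whose simplices are the nonempty (not necessarily saturated) chains of $\mathcal{O}(\mathcal{H})$. On morphisms, $\mathcal{B}^{\mathcal{O}}_{res}$ sends $f:V\to V'$ to the induced map on hyperedges $E\to E'$, $e\mapsto\{f(v):v\in e\}$. *)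

(* Defs.v *)
From HB Require Import structures.
From mathcomp Require Import all_boot all_order.
From mathcomp Require Import boolp classical_sets.

Set Implicit Arguments.
Unset Strict Implicit.
Unset Printing Implicit Defensive.

Local Open Scope classical_set_scope.

Record category := Category {
  obj :> Type;
  hom : obj -> obj -> Type;
  idm : forall a, hom a a;
  compm : forall a b c, hom b c -> hom a b -> hom a c;
  compm_idl : forall a b (f : hom a b), compm (idm b) f = f;
  compm_idr : forall a b (f : hom a b), compm f (idm a) = f;
  compm_assoc : forall a b c d (h : hom c d) (g : hom b c) (f : hom a b),
    compm h (compm g f) = compm (compm h g) f }.

Arguments hom {_} a b : rename.
Arguments idm {_} a : rename.
Arguments compm {_ a b c} g f : rename.

Definition is_functor (C D : category) (Fobj : C -> D)
    (Fhom : forall a b : C, hom a b -> hom (Fobj a) (Fobj b)) : Prop :=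
  (forall a : C, Fhom a a (idm a) = idm (Fobj a)) /\
  (forall (a b c : C) (g : hom b c) (f : hom a b),
     Fhom a c (compm g f) = compm (Fhom b c g) (Fhom a b f)).

(* The hyperedges form a set of sets, so there are no multi-edges; [set0] may
   be a hyperedge. *)
Record hypergraph := Hypergraph {
  vertex : finType;
  edges : {set {set vertex}} }.

Record hyp_hom (H H' : hypergraph) := HypHom {
  hyp_fun :> vertex H -> vertex H';
  hyp_funP : forall e : {set vertex H}, e \in edges H -> hyp_fun @: e \in edges H' }.

Lemma hyp_hom_eq (H H' : hypergraph) (f g : hyp_hom H H') :
  f =1 g -> f = g.
Proof.
case: f g => [f fP] [g gP] /= /funext fg; case: _ / fg gP => gP.
by rewrite (Prop_irrelevance fP gP).
Qed.

Lemma hyp_id_subproof (H : hypergraph) (e : {set vertex H}) :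
  e \in edges H -> id @: e \in edges H.
Proof. by rewrite imset_id. Qed.

Definition hyp_id (H : hypergraph) : hyp_hom H H := HypHom (@hyp_id_subproof H).

Lemma hyp_comp_subproof (H1 H2 H3 : hypergraph)
    (g : hyp_hom H2 H3) (f : hyp_hom H1 H2) (e : {set vertex H1}) :
  e \in edges H1 -> (g \o f) @: e \in edges H3.
Proof. by move=> eH; rewrite imset_comp; do 2!apply: hyp_funP. Qed.

Definition hyp_comp (H1 H2 H3 : hypergraph)
    (g : hyp_hom H2 H3) (f : hyp_hom H1 H2) : hyp_hom H1 H3 :=
  HypHom (hyp_comp_subproof g f).

Definition Hyp : category.
Proof.
refine (@Category hypergraph hyp_hom hyp_id hyp_comp _ _ _);
  by move=> *; apply: hyp_hom_eq.
Defined.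

Record simplicial_complex := SimplicialComplex {
  base : Type;
  simplices : set (set base);
  simplex_neq0 : forall s : set base, simplices s -> s !=set0;
  simplex_sub : forall s t : set base,
    simplices s -> t `<=` s -> t !=set0 -> simplices t }.

Record simp_hom (K K' : simplicial_complex) := SimpHom {
  simp_fun :> base K -> base K';
  simp_funP : forall s : set (base K),
    simplices s -> simplices (simp_fun @` s) }.

Lemma simp_hom_eq (K K' : simplicial_complex) (f g : simp_hom K K') :
  f =1 g -> f = g.
Proof.
case: f g => [f fP] [g gP] /= /funext fg; case: _ / fg gP => gP.
by rewrite (Prop_irrelevance fP gP).
Qed.

Lemma simp_id_subproof (K : simplicial_complex) (s : set (base K)) :
  simplices s -> simplices (id @` s).
Proof. by rewrite image_id. Qed.

Definition simp_id (K : simplicial_complex) : simp_hom K K :=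
  SimpHom (@simp_id_subproof K).

Lemma simp_comp_subproof (K1 K2 K3 : simplicial_complex)
    (g : simp_hom K2 K3) (f : simp_hom K1 K2) (s : set (base K1)) :
  simplices s -> simplices ((g \o f) @` s).
Proof. by move=> sK; rewrite -image_comp; do 2!apply: simp_funP. Qed.

Definition simp_comp (K1 K2 K3 : simplicial_complex)
    (g : simp_hom K2 K3) (f : simp_hom K1 K2) : simp_hom K1 K3 :=
  SimpHom (simp_comp_subproof g f).

Definition Simp : category.
Proof.
refine (@Category simplicial_complex simp_hom simp_id simp_comp _ _ _);
  by move=> *; apply: simp_hom_eq.
Defined.

Section OrderComplex.
Context {d : Order.disp_t} (P : porderType d).

Definition chains : set (set P) :=
  [set C | C !=set0 /\ total_on C (fun x y => (x <= y)%O)].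

Lemma chains_neq0 (C : set P) : chains C -> C !=set0.
Proof. by case. Qed.

Lemma chains_sub (C D : set P) :
  chains C -> D `<=` C -> D !=set0 -> chains D.
Proof. by move=> [_ Ctot] DC D0; split=> // x y /DC Cx /DC Cy; apply: Ctot. Qed.

Definition order_complex : simplicial_complex :=
  SimplicialComplex chains_neq0 chains_sub.
End OrderComplex.

(* [DefaultSetSubsetOrder] orders [{set V}] by inclusion. *)
Import Order.DefaultSetSubsetOrder.

Record edge_poset (H : hypergraph) := Edge {
  edge_set : {set vertex H};
  edge_setP : edge_set \in edges H }.

HB.instance Definition _ (H : hypergraph) := [isSub for @edge_set H].
HB.instance Definition _ (H : hypergraph) := [Choice of edge_poset H by <:].
HB.instance Definition _ (H : hypergraph) :=
  [SubChoice_isSubPOrder of edge_poset H by <: with Order.SetSubsetOrder.subset_display].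

Definition BresO (H : hypergraph) : simplicial_complex :=
  order_complex (edge_poset H).

Definition edge_map (H H' : hypergraph) (f : hyp_hom H H')
    (e : edge_poset H) : edge_poset H' :=
  @Edge H' (f @: edge_set e) (hyp_funP f (edge_setP e)).

(* Main.v *)
Require Import Defs.
From mathcomp Require Import all_boot all_order.
From mathcomp Require Import boolp classical_sets.

Set Implicit Arguments.
Unset Strict Implicit.
Unset Printing Implicit Defensive.

Local Open Scope classical_set_scope.

(** Direct image preserves inclusion, so a hypergraph morphism induces a monotone map of hyperedge
    posets ([edge_map_homo]). Monotone maps send nonempty chains to nonempty chains
    ([chains_image]), so the induced map is simplicial. The functor laws come from those of direct
    images. *)

Lemma chains_image d d' (P : porderType d) (Q : porderType d') (f : P -> Q) :
  {homo f : x y / (x <= y)%O} -> forall C, chains C -> chains (f @` C).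
Proof.
move=> f_mono C [[x Cx] Ctot]; split; first by exists (f x), x.
move=> _ _ [y Cy <-] [z Cz <-].
by case: (Ctot y z Cy Cz) => /f_mono; [left | right].
Qed.

Lemma le_edgeE (H : hypergraph) (e e' : edge_poset H) :
  (e <= e')%O = (edge_set e \subset edge_set e').
Proof. by rewrite -Order.le_val Order.SetSubsetOrder.leEsubset. Qed.

Lemma edge_map_homo (H H' : hypergraph) (f : hyp_hom H H') :
  {homo edge_map f : e e' / (e <= e')%O}.
Proof. by move=> e e'; rewrite !le_edgeE; apply: imsetS. Qed.

Definition BresO_hom (H H' : hypergraph) (f : hyp_hom H H') :
    simp_hom (BresO H) (BresO H') :=
  @SimpHom (BresO H) (BresO H') (edge_map f) (chains_image (edge_map_homo f)).

(** Membership in [edges H] is a boolean condition, so a hyperedge is determined by its underlying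
    set; [val_inj] thus reduces both functor laws to equalities of [imset]s. *)
Lemma edge_map_id (H : hypergraph) : edge_map (hyp_id H) =1 id.
Proof. by move=> e; apply/val_inj; apply: imset_id. Qed.

Lemma edge_map_comp (H1 H2 H3 : hypergraph) (g : hyp_hom H2 H3)
    (f : hyp_hom H1 H2) : edge_map (hyp_comp g f) =1 edge_map g \o edge_map f.
Proof. by move=> e; apply/val_inj; apply: imset_comp. Qed.

(** The existential hides only the proofs of simpliciality: the first conjunct fixes the values of
    [Bhom], hence [Bhom] itself by [simp_hom_eq]. *)
Theorem proposition17 :
  exists Bhom : forall H H' : hypergraph,
      hyp_hom H H' -> simp_hom (BresO H) (BresO H'),
    (forall (H H' : hypergraph) (f : hyp_hom H H') (e : edge_poset H),
       Bhom H H' f e = edge_map f e) /\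
    @is_functor Hyp Simp BresO Bhom.
Proof.
exists BresO_hom; split=> //; split=> [H | H1 H2 H3 g f].
- by apply: simp_hom_eq; apply: edge_map_id.
- by apply: simp_hom_eq; apply: edge_map_comp.
Qed.
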